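(* Every hyperbolic cover $(\tilde W,\tilde S)$ of a Coxeter system $(W,S)$ of finite rank is isomorphic to the Coxeter system $(W,S)$, i.e. there is a group isomorphism $\tilde W\to W$ mapping $\tilde S$ bijectively onto $S$.
   Context: Let $(W,S)$ be a Coxeter system of finite rank $n$, $S=\{s_1,\dots,s_n\}$, with Tits' representation $\rho:W\to\mathrm{GL}(V)$ on the real vector space $V$ with its associated symmetric bilinear form $(-\mid-)$, and let $\alpha_1,\dots,\alpha_n$ be the fundamental system (simple roots), so that $\rho(s_i)$ is the reflection of $V$ with respect to $\alpha_i$. Let $(m_1,m_2,m_0)$ be the signature of $(-\mid-)$ (numbers of positive, negative and zero eigenvalues). A hyperbolic extended space of $(V,(-\mid-))$ is a real vector space $\tilde V\supseteq V$ with a symmetric bilinear form extending that of $V$, whose signature is $(m_1+x,m_2+x,m_0-x)$ for some integer $x\ge0$. Given such a $\tilde V$, let $\tilde s_i$ be the reflection of $\tilde V$ with respect to $\alpha_i$, i.e. $\tilde s_i(v)=v-\frac{2(\alpha_i\mid v)}{(\alpha_i\mid\alpha_i)}\alpha_i$, let $\tilde S=\{\tilde s_1,\dots,\tilde s_n\}$ and $\tilde W=\langle\tilde S\rangle\le\mathrm{GL}(\tilde V)$. Then $(\tilde W,\tilde S)$ is called a hyperbolic cover of $(W,S)$. *)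

(* Defs.v *)
From HB Require Import structures.
From mathcomp Require Import all_boot all_order all_algebra.
From mathcomp Require Import ring.
From mathcomp Require Import all_classical all_reals all_analysis.

Set Implicit Arguments.
Unset Strict Implicit.
Unset Printing Implicit Defensive.

Import Order.TTheory GRing.Theory Num.Theory.

Local Open Scope classical_set_scope.
Local Open Scope ring_scope.

Section GeneratedSubgroup.
Variables (G : groupType) (A : set G).
Local Open Scope group_scope.

Definition generated : set G :=
  smallest [set H : set G | group_closed (mem H)] A.

Lemma generated_group_closed : group_closed (mem generated).
Proof.
split.
  by apply/mem_set => H [HG _]; apply/set_mem; exact: HG.1.
move=> x y /set_mem xG /set_mem yG; apply/mem_set => H HA.
by apply/set_mem/(HA.1.2); apply/mem_set; [exact: xG|exact: yG].
Qed.

Definition generated_pred : pred G := fun g => g \in generated.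

Record generated_group :=
  GeneratedGroup { generated_val : G ; _ : generated_pred generated_val }.

HB.instance Definition _ := [isSub for generated_val].
HB.instance Definition _ := [Choice of generated_group by <:].

Lemma generated_pred_closed : group_closed generated_pred.
Proof. exact: generated_group_closed. Qed.

HB.instance Definition _ :=
  SubChoice_isSubGroup.Build G generated_pred generated_group generated_pred_closed.

End GeneratedSubgroup.

Section GeneralLinear.
Variables (K : fieldType) (V : vectType K).

(* 'End(V) is a (nonzero) ring only for V of positive dimension, so that the
   general linear group is not taken to be its unit group.  The product of
   GL V is the composition of endomorphisms: (g * h) v = g (h v). *)
Record GL := MkGL { GLfun :> 'End(V) ; _ : lker GLfun == 0%VS }.

HB.instance Definition _ := [isSub for GLfun].
HB.instance Definition _ := [Choice of GL by <:].

Lemma GL_ker (g : GL) : lker g == 0%VS. Proof. by case: g. Qed.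

Lemma GL_mul_subproof (g h : GL) : lker (g \o h)%VF == 0%VS.
Proof.
apply/lker0P => u v; rewrite !comp_lfunE => /(lker0P (GL_ker g)).
exact: (lker0P (GL_ker h)).
Qed.

Lemma GL_one_subproof : lker (\1%VF : 'End(V)) == 0%VS.
Proof. by apply/lker0P => u v; rewrite !id_lfunE. Qed.

Lemma GL_inv_subproof (g : GL) : lker (g^-1)%VF == 0%VS.
Proof.
apply/lker0P => u v /(congr1 g).
by rewrite -!comp_lfunE !(lker0_compfV (GL_ker g)) !id_lfunE.
Qed.

Definition GL_mul g h := MkGL (GL_mul_subproof g h).
Definition GL_one := MkGL GL_one_subproof.
Definition GL_inv g := MkGL (GL_inv_subproof g).

Lemma GL_mulA : associative GL_mul.
Proof. by move=> f g h; apply/val_inj; rewrite /= comp_lfunA. Qed.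

Lemma GL_mul1 : left_id GL_one GL_mul.
Proof. by move=> g; apply/val_inj; rewrite /= comp_lfun1l. Qed.

Lemma GL_mulr1 : right_id GL_one GL_mul.
Proof. by move=> g; apply/val_inj; rewrite /= comp_lfun1r. Qed.

Lemma GL_mulV : left_inverse GL_one GL_inv GL_mul.
Proof. by move=> g; apply/val_inj; rewrite /= lker0_compVf// GL_ker. Qed.

Lemma GL_mulrV : right_inverse GL_one GL_inv GL_mul.
Proof. by move=> g; apply/val_inj; rewrite /= lker0_compfV// GL_ker. Qed.

HB.instance Definition _ :=
  isGroup.Build GL GL_mulA GL_mul1 GL_mulr1 GL_mulV GL_mulrV.

End GeneralLinear.

Section Reflection.
Variables (R : realType) (V : vectType R) (B : {symmetric V}) (a : V).

Definition refl_fun (v : V) : V := v - (2 * B a v / B a a) *: a.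

Lemma refl_fun_linear : linear refl_fun.
Proof.
move=> k u v.
have BE : B a (k *: u + v) = k * B a u + B a v by rewrite linearP.
rewrite /refl_fun BE scalerBr scalerA [RHS]addrACA -opprD -scalerDl.
by congr (_ - _ *: _); rewrite mulrDr mulrDl mulrCA !mulrA.
Qed.

HB.instance Definition _ :=
  GRing.isLinear.Build R V V *:%R refl_fun refl_fun_linear.

Lemma refl_funK : involutive refl_fun.
Proof.
move=> v; rewrite /refl_fun.
set c := 2 * B a v / B a a.
have -> : B a (v - c *: a) = B a v - c * B a a.
  by rewrite addrC -scaleNr linearP /= mulNr addrC.
rewrite {}/c.
have [->|Ba0] := eqVneq (B a a) 0; first by rewrite invr0 !mulr0 !scale0r !subr0.
rewrite -addrA -opprD -scalerDl -[RHS]subr0; congr (_ - _).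
rewrite divfK//.
have -> : 2 * B a v / B a a + 2 * (B a v - 2 * B a v) / B a a = 0.
  by rewrite -mulrDl (_ : _ + _ = 0) ?mul0r//; ring.
by rewrite scale0r.
Qed.

Lemma refl_lker : lker (linfun refl_fun) == 0%VS.
Proof.
by apply/lker0P => u v; rewrite !lfunE; exact: (inv_inj refl_funK).
Qed.

(* If B a a = 0, this is the identity, by the convention x / 0 = 0. *)
Definition reflection : GL V := MkGL refl_lker.

End Reflection.

Section Signature.
Variables (R : realType) (V : vectType R) (B : V -> V -> R).

Definition gram_matrix (k : nat) (e : k.-tuple V) : 'M[R]_k :=
  \matrix_(i, j) B (tnth e i) (tnth e j).

(* The list r consists of the eigenvalues of the Gram matrix of B in a basis,
   counted with multiplicity; by Sylvester's law of inertia the numbers p, q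
   and z do not depend on this basis. *)
Definition has_signature (p q z : nat) : Prop :=
  exists2 e : (\dim {:V}).-tuple V, basis_of {:V} e &
  exists2 r : seq R,
    char_poly (gram_matrix e) = \prod_(x <- r) ('X - x%:P) &
    [/\ count (fun x => 0 < x) r = p,
        count (fun x => x < 0) r = q &
        count (fun x => x == 0) r = z].

End Signature.

Section CoxeterSystem.
Variable n : nat.

(* The value 0 encodes an infinite entry of the matrix. *)
Definition coxeter_matrix (m : 'M[nat]_n) : Prop :=
  [/\ forall i, m i i = 1%N,
      forall i j, m i j = m j i &
      forall i j, i != j -> m i j != 1%N].

(* As x ^+ 0 = 1, an infinite entry imposes no relation. *)
Definition coxeter_relations (m : 'M[nat]_n) (G : groupType) (f : 'I_n -> G) :
    Prop :=
  forall i j, ((f i * f j) ^+ m i j = 1)%g.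

(* W = < s_1, ..., s_n | (s_i s_j)^(m i j) = 1 > *)
Definition coxeter_system (m : 'M[nat]_n) (W : groupType) (s : 'I_n -> W) :
    Prop :=
  [/\ coxeter_matrix m,
      generated (range s) = [set: W],
      coxeter_relations m s &
      forall (G : groupType) (f : 'I_n -> G), coxeter_relations m f ->
        exists h : {multiplicative W -> G}, forall i, h (s i) = f i].

End CoxeterSystem.

Section TitsForm.
Variables (R : realType) (n : nat).

Definition simple_root (i : 'I_n) : 'rV[R]_n := delta_mx 0 i.

(* For an infinite (i.e. 0) entry of m, the coefficient is - cos 0 = -1. *)
Definition tits_matrix (m : 'M[nat]_n) : 'M[R]_n :=
  \matrix_(i, j) - cos (pi / (m i j)%:R).

Definition tits_form (m : 'M[nat]_n) (u v : 'rV[R]_n) : R :=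
  (u *m tits_matrix m *m v^T) 0 0.

End TitsForm.

Section HyperbolicCover.
Variables (R : realType) (n : nat) (m : 'M[nat]_n).
Variables (Vt : vectType R) (Bt : {symmetric Vt}).
(* The inclusion of the space of the Tits representation in Vt. *)
Variable iota : {linear 'rV[R]_n -> Vt}.

Definition hyperbolic_extension : Prop :=
  [/\ injective iota,
      forall u v, Bt (iota u) (iota v) = tits_form m u v &
      exists m1 m2 m0 x : nat,
        [/\ has_signature (@tits_form R n m) m1 m2 m0,
            (x <= m0)%N &
            has_signature Bt (m1 + x) (m2 + x) (m0 - x)]].

Definition cover_reflection (i : 'I_n) : GL Vt :=
  reflection Bt (iota (simple_root R i)).

Definition cover_group : groupType := generated_group (range cover_reflection).

Definition cover_generators : set cover_group :=
  [set g | range cover_reflection (generated_val g)].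

End HyperbolicCover.

Arguments cover_generators {R n Vt} Bt iota.

(* Main.v *)
Require Import Defs.
From HB Require Import structures.
From mathcomp Require Import all_boot all_order all_algebra.
From mathcomp Require Import ring zify.
From mathcomp Require Import all_classical all_reals all_analysis.

(** A Coxeter group acts on a hyperbolic cover just as it acts on the space of
its Tits representation, and one argument covers both. Write r_i for the
reflection of the extended space in the simple root alpha_i.

The reflections r_i satisfy the Coxeter relations
([root_reflection_relations]): when m_ij is finite the form is positive
definite on the plane spanned by alpha_i and alpha_j, so the extended space is
the sum of that plane, where r_i r_j is a rotation of angle 2 pi / m_ij, and
of its orthogonal, which r_i and r_j fix. Hence s_i |-> r_i extends to a
morphism h from W onto the cover group.

It remains to see that h is injective, which is the faithfulness of the Tits
representation. The point ([ascent_in_cone]) is that a simple root alpha_i is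
sent by w to a combination of simple roots with nonnegative coefficients as
soon as w s_i is not shorter than w. If w <> 1 acts trivially, write w = w' s_i
with w' shorter; then h w' = r_i sends alpha_i to - alpha_i, which is not such
a combination ([tits_kernel]).

The positivity is proved by induction on the length of w. If w ends in s_j,
factor w = v u with u in the dihedral group of s_i and s_j, lengths adding up,
and v as short as possible ([dihedral_decomposition]). Minimality makes v s_i
and v s_j no shorter than v, so v sends alpha_i and alpha_j into the cone by
induction. As for u, it is forced to be the alternating word that ends in j,
of length k less than m_ij ([dihedral_word], [dihedral_length]), and it sends
alpha_i to a combination of alpha_i and alpha_j whose coefficients are
sin ((k + 1) theta) / sin theta and sin (k theta) / sin theta with
theta = pi / m_ij ([alternating_root]); they are nonnegative since
k + 1 <= m_ij. For m_ij infinite they are k + 1 and k. *)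

Set Implicit Arguments.
Unset Strict Implicit.
Unset Printing Implicit Defensive.

Import Order.TTheory GRing.Theory Num.Theory.

Local Open Scope classical_set_scope.
Local Open Scope ring_scope.

(** * Words in involutions *)

Section Alternating.
Variable I : Type.

Definition letter (i j : I) (l : nat) : I := if odd l then j else i.

(** Positions are numbered from right to left, a being the rightmost one, so that
a letter added on the left keeps the numbering. From a = 1 the word ends in j;
starting at 0 instead appends an i to it. *)
Definition alternating_word (i j : I) (a k : nat) : seq I :=
  [seq letter i j l | l <- rev (iota a k)].

Lemma alternatingS i j a k :
  alternating_word i j a k.+1 = letter i j (a + k) :: alternating_word i j a k.
Proof. by rewrite /alternating_word -addn1 iotaD rev_cat map_cat. Qed.

Lemma alternatingD i j a k l :
  alternating_word i j a (k + l) =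
    alternating_word i j (a + k) l ++ alternating_word i j a k.
Proof. by rewrite /alternating_word iotaD rev_cat map_cat. Qed.

Lemma size_alternating_word i j a k : size (alternating_word i j a k) = k.
Proof. by rewrite size_map size_rev size_iota. Qed.

Lemma letterSS i j l : letter i j l.+2 = letter i j l.
Proof. by rewrite /letter /= negbK. Qed.

End Alternating.

Section Words.
Local Open Scope group_scope.
Variables (I : eqType) (W : groupType) (s : I -> W).

Definition word (t : seq I) : W := \prod_(x <- t) s x.

Lemma word_cat t u : word (t ++ u) = word t * word u.
Proof. exact: big_cat. Qed.

Lemma word_cons i t : word (i :: t) = s i * word t.
Proof. exact: big_cons. Qed.

Lemma word_rcons t i : word (rcons t i) = word t * s i.
Proof. by rewrite -cats1 word_cat /word big_seq1. Qed.

Lemma word_alternating i j a k :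
  word (alternating_word i j a k.*2) =
    (s (letter i j a.+1) * s (letter i j a)) ^+ k.
Proof.
elim: k => [|k IHk]; first by rewrite /word big_nil.
rewrite doubleS !alternatingS !word_cons IHk expgS mulgA addnS.
by rewrite /letter /= oddD odd_double addbF.
Qed.

Definition geodesic (t : seq I) : Prop :=
  forall t', word t' = word t -> (size t <= size t')%N.

(** With w the product of a geodesic t, this asks that w s_i be no shorter than w.
The weak inequality spares the parity argument that makes it strict. *)
Definition ascent (t : seq I) (i : I) : Prop :=
  forall t', word t' = word t * s i -> (size t <= size t')%N.

Lemma geodesic_prefix v u : geodesic (v ++ u) -> geodesic v.
Proof.
move=> g t' E; have := g (t' ++ u); rewrite !word_cat E !size_cat leq_add2r.
exact.
Qed.

Lemma geodesic_suffix v u : geodesic (v ++ u) -> geodesic u.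
Proof.
move=> g t' E; have := g (v ++ t'); rewrite !word_cat E !size_cat leq_add2l.
exact.
Qed.

Lemma ascent_suffix v u i : ascent (v ++ u) i -> ascent u i.
Proof.
move=> g t' E; have := g (v ++ t').
by rewrite !word_cat E !size_cat leq_add2l mulgA; exact.
Qed.

Hypothesis sK : forall i, s i * s i = 1.

Lemma word_rev t : word t * word (rev t) = 1.
Proof.
elim: t => [|i t IHt]; first by rewrite /word !big_nil mulg1.
rewrite rev_cons -cats1 word_cat word_cons /word big_seq1 -/word -mulgA.
by rewrite (mulgA (word t)) IHt mul1g sK.
Qed.

(** In a geodesic word a repeated letter would cancel, so the letters alternate;
and a final i would be cancelled by the generator i. *)
Lemma dihedral_word i j u : {subset u <= [:: i; j]} ->
  geodesic u -> ascent u i -> u = alternating_word i j 1 (size u).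
Proof.
elim: u => [//|x u IHu] uij gu au.
have Eu : u = alternating_word i j 1 (size u).
  apply: IHu; first by move=> y yu; apply: uij; rewrite inE yu orbT.
    exact: (@geodesic_suffix [:: x]) gu.
  exact: (@ascent_suffix [:: x]) au.
rewrite [size _]/= alternatingS -Eu add1n; congr (_ :: _).
clear IHu.
have xN : x != letter i j (size u).
  apply/negP => /eqP xE.
  case: u Eu => [|y u] Eu in gu au uij xE *.
    by have := au [::]; rewrite xE /word big_seq1 big_nil sK => /(_ erefl).
  move: Eu; rewrite [size (y :: u)]/= alternatingS add1n => -[yE _].
  have := gu u; rewrite xE !word_cons -yE mulgA sK mul1g => /(_ erefl) /=.
  by lia.
have := uij x (mem_head _ _); move: xN; rewrite !inE /letter /=.
by case: (odd _) => /= /negPf->; rewrite ?orbF => /eqP.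
Qed.

(** An alternating word of length m or more ends with one of length m; appending
i to the latter gives an alternating word of length m + 1, which the relation
turns into the inverse of one of length m - 1. *)
Lemma dihedral_length i j m u : (0 < m)%N -> (s j * s i) ^+ m = 1 ->
  ascent u i -> u = alternating_word i j 1 (size u) -> (size u < m)%N.
Proof.
move=> m0 sm au uE; rewrite ltnNge; apply/negP => mu.
have am : ascent (alternating_word i j 1 m) i.
  apply: (@ascent_suffix (alternating_word i j (1 + m) (size u - m))).
  by rewrite -alternatingD subnKC // -uE.
have := am (rev (alternating_word i j m.+1 m.-1)).
rewrite size_rev !size_alternating_word => H.
suff /H : word (rev (alternating_word i j m.+1 m.-1)) =
    word (alternating_word i j 1 m) * s i by lia.
(* multiplied on the left by the letters at positions m + 1 to 2 m - 1, the
   right-hand side is alternating of length 2 m, that is (s_j s_i)^m *)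
apply: (@mulgI _ (word (alternating_word i j m.+1 m.-1))).
rewrite word_rev mulgA -word_cat -[in X in X ++ _]add1n -alternatingD.
have -> : s i = word (alternating_word i j 0 1) by rewrite /word big_seq1.
rewrite -word_cat -(alternatingD i j 0 1).
have -> : (1 + (m + m.-1) = m.*2)%N by lia.
by rewrite word_alternating.
Qed.

(** Moving a letter i or j from v to u whenever this shortens v ends at a v that
neither letter shortens; the lengths of v and u keep adding up because their
product is geodesic. *)
Lemma coset_minimal t i j v u : geodesic t -> {subset u <= [:: i; j]} ->
    word (v ++ u) = word t -> size (v ++ u) = size t ->
  exists v' u', [/\ (size v' <= size v)%N, ascent v' i, ascent v' j,
    {subset u' <= [:: i; j]} & word (v' ++ u') = word t /\
    size (v' ++ u') = size t].
Proof.
move=> gt; have [k] := ubnP (size v).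
elim: k v u => [//|k IHk] v u vk uij vuE vus.
have [[avi avj]|nav] := pselect (ascent v i /\ ascent v j).
  by exists v, u.
have [x xij [v' v'E v'v]] : exists2 x, x \in [:: i; j] &
    exists2 v', word v' = word v * s x & (size v' < size v)%N.
  apply: contrapT => nx; apply: nav; split=> v' v'E; rewrite leqNgt;
    apply/negP => v'v; apply: nx; [exists i|exists j];
    rewrite ?inE ?eqxx ?orbT //; by exists v'.
have E : word (v' ++ x :: u) = word t.
  by rewrite -vuE !word_cat word_cons v'E mulgA -(mulgA (word v)) sK mulg1.
have [||||v2 [u2 [v2v' ? ? ? ?]]] := IHk v' (x :: u).
- lia.
- by move=> y; rewrite inE => /predU1P[->//|/uij].
- exact: E.
- have := gt _ E; rewrite -vus !size_cat /=; lia.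
by exists v2, u2; split=> //; lia.
Qed.

(** The word t does not end in i, as i is an ascent; if it ends in j, splitting
off that letter starts the descent to the minimal element of the coset of the
dihedral group of i and j. *)
Lemma dihedral_decomposition t i : geodesic t -> ascent t i -> t != [::] ->
  exists j v u, i != j /\ [/\ word (v ++ u) = word t, (size v < size t)%N &
    [/\ geodesic v, ascent v i & ascent v j] /\
    [/\ ascent u i & u = alternating_word i j 1 (size u)]].
Proof.
move=> gt at_; case/lastP: t => [//|t j] in gt at_ * => _.
have ij : i != j.
  apply/negP => /eqP ij; have := at_ t.
  rewrite word_rcons ij -mulgA sK mulg1 size_rcons => /(_ erefl); lia.
have [|||v [u [vt avi avj uij [vuE vus]]]] := @coset_minimal _ i j t [:: j] gt.
- by move=> x; rewrite !inE orbC => ->.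
- by rewrite cats1.
- by rewrite cats1.
have gvu : geodesic (v ++ u) by move=> t' E; rewrite vus; apply: gt; rewrite E.
have au : ascent u i.
  apply: (@ascent_suffix v) => t' E; rewrite vus; apply: at_.
  by rewrite E vuE.
exists j, v, u; split=> //; split=> //; first by rewrite size_rcons ltnS.
split; first by split=> //; exact: geodesic_prefix gvu.
by split=> //; apply: dihedral_word => //; exact: geodesic_suffix gvu.
Qed.

End Words.

(** * Multiples of an angle *)

Section Chebyshev.
Variable R : realType.
Implicit Types c x : R.

(** The Chebyshev polynomial of the second kind, of degree k - 1, at c: this is
sin (k x) / sin x for c = cos x, and still makes sense at c = 1. *)
Fixpoint cheb c (k : nat) : R :=
  match k with
  | 0 => 0
  | k'.+1 => if k' is k''.+1 then 2 * c * cheb c k' - cheb c k'' else 1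
  end.

Lemma chebSS c k : cheb c k.+2 = 2 * c * cheb c k.+1 - cheb c k.
Proof. by []. Qed.

Lemma cheb_sin x k : sin x * cheb (cos x) k = sin (k%:R * x).
Proof.
elim/ltn_ind: k => -[|[|k]] IHk; first by rewrite mulr0 mul0r sin0.
  by rewrite mulr1 mul1r.
rewrite chebSS mulrBr mulrCA !IHk //.
have -> : k.+2%:R * x = k.+1%:R * x + x.
  by rewrite -[k.+2]addn1 natrD mulrDl mul1r.
have -> : k%:R * x = k.+1%:R * x - x.
  by rewrite -[k.+1]addn1 natrD mulrDl mul1r addrK.
rewrite sinB sinD; ring.
Qed.

Lemma cheb1 k : cheb 1 k = k%:R.
Proof.
elim/ltn_ind: k => -[|[|k]] IHk //; rewrite chebSS !IHk // -[k.+2]addn1.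
rewrite -[k.+1]addn1 !natrD; ring.
Qed.

Lemma sin_pi_div_gt0 m : (1 < m)%N -> 0 < sin (pi / m%:R : R).
Proof.
move=> m1; apply: sin_gt0_pi.
have m0 : 0 < m%:R :> R by rewrite ltr0n; exact: ltnW.
by rewrite divr_gt0 ?pi_gt0 //= gtr_pMr ?pi_gt0 // invf_lt1 // ltr1n.
Qed.

(** For m = 0, the code of an infinite entry, the angle is 0 and the value k. *)
Lemma cheb_ge0 m k : m != 1%N -> (0 < m -> k <= m)%N ->
  0 <= cheb (cos (pi / m%:R)) k.
Proof.
case: m => [|[//|m]] _ km.
  by rewrite invr0 mulr0 cos0 cheb1.
rewrite -(pmulr_rge0 _ (@sin_pi_div_gt0 m.+2 _)) // cheb_sin.
apply: sin_ge0_pi; rewrite mulr_ge0 ?divr_ge0 ?pi_ge0 //=.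
by rewrite mulrCA ger_pMr ?pi_gt0 // ler_pdivrMr ?mul1r ?ler_nat ?km.
Qed.

Lemma double_mul_pi_div m : (0 < m)%N -> m.*2%:R * (pi / m%:R) = pi *+ 2 :> R.
Proof.
move=> m0; rewrite -mul2n natrM -mulrA (mulrC m%:R) divfK ?mulr_natl //.
by rewrite pnatr_eq0 -lt0n.
Qed.

Lemma cheb_double m : (1 < m)%N -> cheb (cos (pi / m%:R)) m.*2 = 0.
Proof.
move=> m1; apply: (mulfI (lt0r_neq0 (sin_pi_div_gt0 m1))).
rewrite cheb_sin mulr0 double_mul_pi_div ?(ltnW m1) //.
by rewrite -[_ *+ _]add0r sinD2pi sin0.
Qed.

Lemma cheb_doubleS m : (1 < m)%N -> cheb (cos (pi / m%:R)) m.*2.+1 = 1.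
Proof.
move=> m1; apply: (mulfI (lt0r_neq0 (sin_pi_div_gt0 m1))).
rewrite cheb_sin mulr1 -addn1 natrD mulrDl mul1r.
by rewrite double_mul_pi_div ?(ltnW m1) // addrC sinD2pi.
Qed.

End Chebyshev.

Arguments cheb {R} c k : simpl never.

(** * Reflections in the simple roots *)

Section GeometricRepresentation.
Variables (R : realType) (n : nat) (m : 'M[nat]_n).
Variables (Vt : vectType R) (Bt : {symmetric Vt}) (al : 'I_n -> Vt).
Hypothesis cm : coxeter_matrix m.
Hypothesis gram : forall i j, Bt (al i) (al j) = - cos (pi / (m i j)%:R).

Let mii i : m i i = 1%N. Proof. by case: cm. Qed.
Let mC i j : m i j = m j i. Proof. by case: cm. Qed.
Let mN1 i j : i != j -> m i j != 1%N. Proof. by case: cm => _ _; exact. Qed.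

Definition root_reflection (i : 'I_n) : GL Vt := reflection Bt (al i).
Local Notation r := root_reflection.

Lemma GL_mulE (g h : GL Vt) v : (g * h)%g v = g (h v).
Proof. exact: comp_lfunE. Qed.

Lemma GL_oneE v : (1%g : GL Vt) v = v.
Proof. exact: id_lfunE. Qed.

Lemma GL_eq (g h : GL Vt) : g =1 h -> g = h.
Proof. by move=> gh; apply/val_inj/lfunP. Qed.

Lemma gram1 i : Bt (al i) (al i) = 1.
Proof. by rewrite gram mii divr1 cospi opprK. Qed.

Lemma root_reflectionE i v : r i v = v - (2 * Bt (al i) v) *: al i.
Proof. by rewrite lfunE /= /refl_fun gram1 divr1. Qed.

Lemma root_reflectionK i : (r i * r i = 1)%g.
Proof.
by apply: GL_eq => v; rewrite GL_mulE GL_oneE !lfunE; exact: refl_funK.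
Qed.

(** Write U_k for [cheb c k]. As (a | b) = - c, the reflection in b sends
U_(k+1) a + U_k b to U_(k+1) a + (2 c U_(k+1) - U_k) b, and the new coefficient
is U_(k+2). *)
Lemma alternating_root i j k : let c := cos (pi / (m i j)%:R) in
  word r (alternating_word i j 1 k) (al i) =
    cheb c k.+1 *: al (letter i j k) + cheb c k *: al (letter i j k.+1).
Proof.
move=> c; elim: k => [|k IHk].
  by rewrite /word big_nil GL_oneE scale1r scale0r addr0.
rewrite alternatingS word_cons GL_mulE {}IHk add1n letterSS linearD !linearZ /=.
rewrite !root_reflectionE gram1 gram.
have -> : m (letter i j k.+1) (letter i j k) = m i j.
  by rewrite /letter /=; case: odd.
rewrite -/c chebSS; set a := al _; set b := al _.
rewrite !scalerBr !scalerA [RHS]addrC -!addrA; congr (_ + _).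
rewrite -!(scaleNr _ b) -!scalerDl; congr (_ *: _); ring.
Qed.

(** For m_ij finite the plane of alpha_i and alpha_j is nondegenerate, of Gram
determinant sin^2 (pi / m_ij), so it is a summand with its orthogonal. The
rotation r_i r_j has order dividing m_ij on the plane by the formula for
alternating words, and is trivial on the orthogonal. *)
Lemma root_reflection_relations : coxeter_relations m r.
Proof.
move=> i j; have [<-|ij] := eqVneq i j; first by rewrite mii root_reflectionK.
have [mij0|mij_neq0] := eqVneq (m i j) 0%N; first by rewrite mij0.
have m1 : (1 < m i j)%N by have := mN1 ij; lia.
have rotE x y :
    word r (alternating_word x y 1 (m i j).*2) = ((r x * r y) ^+ m i j)%g.
  by rewrite word_alternating /letter.
have fixE x y : m x y = m i j -> ((r x * r y) ^+ m i j)%g (al x) = al x.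
  move=> xyE; rewrite -rotE alternating_root xyE cheb_double // cheb_doubleS //.
  by rewrite scale0r addr0 scale1r /letter odd_double.
have rV x : ((r x)^-1 = r x)%g by apply/mulg1_eq/root_reflectionK.
have rotV : ((r i * r j) ^+ m i j = ((r j * r i) ^+ m i j)^-1)%g.
  by rewrite -expVgn invgM !rV.
have fixi := fixE i j erefl.
have fixj : ((r i * r j) ^+ m i j)%g (al j) = al j.
  rewrite rotV -{1}(fixE j i (mC _ _)) -GL_mulE mulVg; exact: GL_oneE.
have fix_orth q : Bt (al i) q = 0 -> Bt (al j) q = 0 ->
    ((r i * r j) ^+ m i j)%g q = q.
  move=> qi qj; elim: (m i j) => [|k IHk]; first exact: GL_oneE.
  by rewrite expgS !GL_mulE IHk !root_reflectionE qj mulr0 scale0r subr0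
    qi mulr0 scale0r subr0.
apply: GL_eq => v; rewrite GL_oneE.
pose c := cos (pi / (m i j)%:R) : R.
have d0 : 1 - c ^+ 2 != 0.
  by rewrite -sin2cos2 expf_neq0 // lt0r_neq0 // sin_pi_div_gt0.
pose a := Bt (al i) v; pose b := Bt (al j) v.
(* p is the orthogonal projection of v on the plane of the two roots *)
pose x := (a + c * b) / (1 - c ^+ 2); pose y := (b + c * a) / (1 - c ^+ 2).
pose p := x *: al i + y *: al j.
have BE k : Bt (al k) (v - p) =
    Bt (al k) v - (x * Bt (al k) (al i) + y * Bt (al k) (al j)).
  by rewrite linearB linearD !linearZ.
have -> : v = p + (v - p) by rewrite addrC subrK.
rewrite linearD; congr (_ + _).
  by rewrite linearD !linearZ /= fixi fixj.
by apply: fix_orth; rewrite BE !gram1 gram ?(mC j i) -/c /x /y; field.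
Qed.

Definition in_cone (v : Vt) : Prop :=
  exists2 x : 'I_n -> R, (forall k, 0 <= x k) & v = \sum_k x k *: al k.

Lemma in_coneD u v : in_cone u -> in_cone v -> in_cone (u + v).
Proof.
move=> [x x0 ->] [y y0 ->]; exists (fun k => x k + y k).
  by move=> k; rewrite addr_ge0.
by rewrite -big_split; apply: eq_bigr => k _; rewrite scalerDl.
Qed.

Lemma in_coneZ k v : 0 <= k -> in_cone v -> in_cone (k *: v).
Proof.
move=> k0 [x x0 ->]; exists (fun l => k * x l).
  by move=> l; rewrite mulr_ge0.
by rewrite scaler_sumr; apply: eq_bigr => l _; rewrite scalerA.
Qed.

Lemma root_in_cone i : in_cone (al i).
Proof.
exists (fun k => (k == i)%:R); first by move=> k; rewrite ler0n.
rewrite (bigD1 i) //= eqxx scale1r big1 ?addr0 // => k /negPf ->.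
exact: scale0r.
Qed.

Variables (W : groupType) (s : 'I_n -> W).
Hypothesis s_relations : coxeter_relations m s.
Variable h : {multiplicative W -> GL Vt}.
Hypothesis hs : forall i, h (s i) = r i.

Let sK i : (s i * s i = 1)%g.
Proof. by have := s_relations i i; rewrite mii. Qed.

Let h1 : h 1%g = 1%g.
Proof. by apply: (@mulgI _ (h 1%g)); rewrite -gmulfM !mulg1. Qed.

Lemma word_morph t : h (word s t) = word r t.
Proof.
elim: t => [|i t IHt]; first by rewrite /word !big_nil h1.
by rewrite !word_cons gmulfM IHt hs.
Qed.

(** In w = v u with u dihedral of length k, u sends alpha_i to a combination of
the two roots whose coefficients are nonnegative as k < m_ij, and v sends both
roots into the cone by induction on the length. *)
Lemma ascent_in_cone t i :
  geodesic s t -> ascent s t i -> in_cone (word r t (al i)).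
Proof.
have [k] := ubnP (size t); elim: k t i => // k IHk t i tk gt at_.
have [->|t0] := eqVneq t [::].
  by rewrite /word big_nil GL_oneE; exact: root_in_cone.
have [j [v [u [ij [vuE vt [[gv avi avj] [au uE]]]]]]] :=
  dihedral_decomposition sK gt at_ t0.
have um : (0 < m i j -> size u < m i j)%N.
  move=> m0; apply: (dihedral_length sK m0 _ au uE).
  by rewrite mC; exact: s_relations.
rewrite -word_morph -vuE word_morph word_cat GL_mulE uE alternating_root.
rewrite linearD !linearZ /=.
have vpos l : in_cone (word r v (al (letter i j l))).
  by rewrite /letter; case: odd; apply: IHk => //; lia.
apply: in_coneD; apply: in_coneZ; rewrite ?vpos ?cheb_ge0 ?mN1 // => /um //.
exact: ltnW.
Qed.

Lemma geodesic_exists w : (exists t, word s t = w) ->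
  exists2 t, geodesic s t & word s t = w.
Proof.
move=> wE; have /ex_minnP[k /asboolP[t [<- <-]] kmin] :
    exists k, `[< exists t, word s t = w /\ size t = k >].
  by have [t tw] := wE; exists (size t); apply/asboolP; exists t.
by exists t => // t' t't; apply: kmin; apply/asboolP; exists t'.
Qed.

(** The linear independence of the simple roots enters in this form. *)
Hypothesis al_pointed : forall i, ~ in_cone (- al i).

(** If w' s_i acts trivially and is longer than w', then w' acts as r_i and
sends alpha_i to its opposite, against positivity. *)
Lemma tits_kernel w : (exists t, word s t = w) -> h w = 1%g -> w = 1%g.
Proof.
move=> /geodesic_exists[t gt <-]; case/lastP: t gt => [|t i] gt.
  by rewrite /word big_nil.
rewrite word_rcons gmulfM word_morph hs => tr1.
have rtE : word r t = r i.
  by apply: (@mulIg _ (r i)); rewrite tr1 root_reflectionK.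
exfalso; apply: (@al_pointed i).
have -> : - al i = word r t (al i).
  by rewrite rtE root_reflectionE gram1 mulr1 scaler_nat mulr2n opprD addNKr.
apply: ascent_in_cone; first by move: gt; rewrite -cats1 => /geodesic_prefix.
move=> t' t'E; have := gt t'; rewrite t'E word_rcons size_rcons => /(_ erefl).
exact: ltnW.
Qed.

Lemma tits_faithful : (forall w, exists t, word s t = w) -> injective h.
Proof.
move=> sword x y xy; apply: (@mulgI _ x^-1%g); rewrite mulVg; apply/esym.
apply: tits_kernel => //; apply: (@mulgI _ (h x)).
by rewrite -gmulfM mulVKg mulg1.
Qed.

End GeometricRepresentation.

(** * The cover group *)

Section GeneratedWords.
Local Open Scope group_scope.
Variables (I : eqType) (G : groupType) (f : I -> G).

Lemma word_generated t : generated (range f) (word f t).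
Proof.
have gc := generated_group_closed (range f).
apply/set_mem; elim: t => [|i t IHt]; first by rewrite /word big_nil; case: gc.
rewrite word_cons; apply: (group_closedM gc) => //; apply/mem_set.
by apply: sub_gen_smallest; exists i.
Qed.

Hypothesis fK : forall i, f i * f i = 1.

(** The products of words form a subgroup: as the generators are involutions,
inverting a product amounts to reversing its word. *)
Lemma generated_word g : generated (range f) g -> exists t, word f t = g.
Proof.
move=> /(_ [set x | exists t, word f t = x]); apply; split; last first.
  by move=> _ [i _ <-]; exists [:: i]; rewrite /word big_seq1.
split; first by apply/mem_set; exists [::]; rewrite /word big_nil.
move=> _ _ /set_mem[t <-] /set_mem[u <-]; apply/mem_set.
exists (t ++ rev u); rewrite word_cat; congr (_ * _).
by apply/esym/mulg1_eq/word_rev.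
Qed.

End GeneratedWords.

Section Cover.
Variables (R : realType) (n : nat) (m : 'M[nat]_n).
Variables (Vt : vectType R) (iota : {linear 'rV[R]_n -> Vt}).

Lemma tits_form_simple_root i j :
  tits_form m (simple_root R i) (simple_root R j) = - cos (pi / (m i j)%:R).
Proof. by rewrite /tits_form trmx_delta -rowE -colE !mxE. Qed.

Lemma opp_root_notin_cone i : injective iota ->
  ~ in_cone (fun i => iota (simple_root R i)) (- iota (simple_root R i)).
Proof.
move=> iota_inj [x x0]; rewrite -linearN.
under eq_bigr do rewrite -linearZ.
rewrite -linear_sum => /iota_inj /rowP/(_ i).
rewrite summxE mxE /simple_root mxE.
rewrite (bigD1 i) //= big1 ?addr0 => [|k /negPf ki]; rewrite !mxE ?eqxx /=.
  by have := x0 i; rewrite mulr1 => xi E; rewrite -E oppr_ge0 ler10 in xi.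
by rewrite eq_sym ki mulr0.
Qed.

End Cover.

Theorem proposition7p4 (R : realType) (n : nat) (m : 'M[nat]_n)
    (W : groupType) (s : 'I_n -> W) (Vt : vectType R) (Bt : {symmetric Vt})
    (iota : {linear 'rV[R]_n -> Vt}) :
  coxeter_system m s ->
  hyperbolic_extension m Bt iota ->
  exists phi : {multiplicative cover_group Bt iota -> W},
    bijective phi /\ set_bij (cover_generators Bt iota) (range s) phi.
Proof.
move=> [cm sgen srel suniv] [iota_inj BtE _].
pose al i := iota (simple_root R i).
have gram i j : Bt (al i) (al j) = - cos (pi / (m i j)%:R).
  by rewrite BtE tits_form_simple_root.
have rK := root_reflectionK Bt al.
have sK i : (s i * s i = 1)%g by have := srel i i; case: (cm) => ->.
have [h hs] := suniv _ _ (root_reflection_relations cm gram).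
have sword w : exists t, word s t = w.
  by apply: (generated_word sK); rewrite sgen.
have h_inj : injective h.
  apply: (tits_faithful cm gram srel hs) => // i.
  exact: opp_root_notin_cone.
have hgen w : generated_pred (range (cover_reflection Bt iota)) (h w).
  have [t <-] := sword w; rewrite (word_morph hs).
  by apply: mem_set; exact: word_generated.
have phi_ex (g : cover_group Bt iota) : exists w, h w == val g.
  have [t tg] := generated_word rK (set_mem (valP g)).
  by exists (word s t); rewrite (word_morph hs) tg.
pose phi g := xchoose (phi_ex g).
have hphi g : h (phi g) = val g by apply/eqP/(xchooseP (phi_ex g)).
have phiM : {morph phi : x y / (x * y)%g}.
  by move=> x y; apply: h_inj; rewrite gmulfM !hphi.
pose phi_mul := isMultiplicative.Build _ _ phi phiM.
pose Phi : {multiplicative cover_group Bt iota -> W} := HB.pack phi phi_mul.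
have phi_inj : injective phi.
  by move=> x y xy; apply: val_inj; rewrite -!hphi xy.
have phiE w (hw : generated_pred _ (h w)) : phi (GeneratedGroup hw) = w.
  by apply: h_inj; rewrite hphi.
exists Phi; split.
  by exists (fun w => GeneratedGroup (hgen w)) => [g|w];
    [apply: phi_inj; rewrite phiE|exact: phiE].
split.
- move=> g [i _ ig]; exists i => //.
  by apply: h_inj; rewrite hs hphi; exact: ig.
- by move=> x y _ _; exact: phi_inj.
- move=> _ [i _ <-]; exists (GeneratedGroup (hgen (s i))); last exact: phiE.
  by exists i => //; rewrite /= hs.
Qed.
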